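(* Let $I$ be a $\sigma$-ideal on a separable metric space $X$ and let $D$ and $E$ be two countable dense subsets of $X$. Let $J=\{a\subseteq D:\mathrm{cl}(a)\in I\}$ and $K=\{a\subseteq E:\mathrm{cl}(a)\in I\}$, where $\mathrm{cl}$ is closure in $X$. Then $J$ and $K$ are isomorphic.
   Context: A $\sigma$-ideal on a set $X$ is a family of subsets of $X$ closed under taking subsets and countable unions; it is always assumed to contain all singletons of $X$. An ideal $J$ of subsets of $D$ and an ideal $K$ of subsets of $E$ are isomorphic if there is a bijection $\rho:D\to E$ such that for every $a\subseteq D$: $a\in J$ if and only if $\rho(a)\in K$, where $\rho(a)$ is the image of $a$. *)

(* Defs.v *)
From HB Require Import structures.
From mathcomp Require Import all_boot all_order all_algebra.
From mathcomp Require Import all_classical all_reals all_analysis.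

Set Implicit Arguments.
Unset Strict Implicit.
Unset Printing Implicit Defensive.

Local Open Scope classical_set_scope.

(* The family A may be empty, so set0 is always a member. Properness is not
   required: setT may be a member. *)
Record sigma_ideal (T : Type) (I : set (set T)) : Prop := SigmaIdeal {
  sigma_ideal_subset : forall A B : set T, A `<=` B -> I B -> I A ;
  sigma_ideal_bigcup : forall A : set (set T),
    countable A -> A `<=` I -> I (\bigcup_(B in A) B) ;
  sigma_ideal_set1 : forall x : T, I [set x] }.

Definition separable (T : topologicalType) : Prop :=
  exists2 S : set T, countable S & dense S.

Definition closure_ideal (T : topologicalType) (I : set (set T)) (D : set T)
  : set (set T) := [set a | a `<=` D /\ I (closure a)].

(* J and K are families of subsets of D and of E respectively. A bijection
   from D to E is represented by a total map on T, whose values outside D are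
   irrelevant; as D and E lie in the same type, every bijection from D to E
   extends to such a map. *)
Definition ideal_isomorphic (T : Type) (D E : set T) (J K : set (set T))
  : Prop :=
  exists2 rho : T -> T, set_bij D E rho &
    forall a : set T, a `<=` D -> (J a <-> K (rho @` a)).

(* Main.v *)
(** A bijection [f] for which, given any [e > 0], only finitely many points are
    moved by [e] or more changes the closure of a set by countably many points
    at most, so it preserves membership of closures in a sigma-ideal. It
    therefore suffices to find such a bijection between [D] and [D `|` E], and
    between [E] and [D `|` E]. This is Hilbert's hotel: each of the countably
    many points [q] of [D `\` E] is the limit of a sequence of points of [E];
    these sequences are taken disjoint, with distances to their limits tending
    to 0 jointly, and every [q] is moved into its sequence, which is shifted
    by one. *)

Require Import Defs.
From HB Require Import structures.
From mathcomp Require Import all_boot all_order all_algebra.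
From mathcomp Require Import all_classical all_reals all_analysis.

Local Open Scope classical_set_scope.

Set Implicit Arguments.
Unset Strict Implicit.

Import Order.TTheory GRing.Theory Num.Theory.

(** * Sigma-ideals and isomorphism of ideals *)

Lemma sigma_ideal_countable (T : Type) (I : set (set T)) (A : set T) :
  sigma_ideal I -> countable A -> I A.
Proof.
move=> sI cA; rewrite (_ : A = \bigcup_(B in set1 @` A) B).
  apply: (sigma_ideal_bigcup sI);
    last by move=> _ [x _ <-]; exact: sigma_ideal_set1.
  exact: sub_countable (card_image_le _ _) cA.
by rewrite bigcup_image bigcup_imset1 image_id.
Qed.

Lemma sigma_ideal_setU (T : Type) (I : set (set T)) (A B : set T) :
  sigma_ideal I -> I A -> I B -> I (A `|` B).
Proof.
move=> sI IA IB; rewrite -bigcup2inE -(bigcup_image _ (bigcup2 A B) id).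
apply: (sigma_ideal_bigcup sI); first exact: sub_countable (card_image_le _ _) _.
by move=> _ [[|[|//]] _ <-].
Qed.

Lemma ideal_isomorphic_sym (T : Type) (D E : set T) (J K : set (set T)) :
  ideal_isomorphic D E J K -> ideal_isomorphic E D K J.
Proof.
move=> [f [fDE finj fsurj] fJK].
have /choice[g gP] y : exists x, E y -> D x /\ f x = y.
  by have [/fsurj[x Dx <-]|nEy] := pselect (E y); [exists x|exists y].
have fg (b : set T) : b `<=` E -> f @` (g @` b) = b.
  move=> bE; apply/seteqP; split => [_ [_ [y by_ <-] <-]|y by_].
    by rewrite (gP _ (bE _ by_)).2.
  by exists (g y); [exists y|rewrite (gP _ (bE _ by_)).2].
exists g; first split.
- by move=> y Ey; exact: (gP _ Ey).1.
- move=> x y /set_mem Ex /set_mem Ey gxy.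
  by rewrite -(gP _ Ex).2 -(gP _ Ey).2 gxy.
- move=> x Dx; exists (f x); first exact: fDE.
  have [Dg fg'] := gP _ (fDE _ Dx).
  by apply: finj => //; exact: mem_set.
- move=> b bE; rewrite -[in K b](fg _ bE); apply: iff_sym; apply: fJK.
  by move=> _ [y by_ <-]; exact: (gP _ (bE _ by_)).1.
Qed.

Lemma ideal_isomorphic_trans (T : Type) (D E F : set T) (J K L : set (set T)) :
  ideal_isomorphic D E J K -> ideal_isomorphic E F K L ->
  ideal_isomorphic D F J L.
Proof.
move=> [f fDE fJK] [g gEF gKL]; exists (g \o f).
  exact: set_bij_comp fDE gEF.
move=> a aD; rewrite -image_comp; apply: iff_trans (fJK _ aD) (gKL _ _).
by move=> _ [x ax <-]; case: fDE => + _ _; apply; exact: aD.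
Qed.

(** * Closures under maps that move few points far *)

Lemma closed_finite_metric (R : realType) (X : metricType R) (A : set X) :
  finite_set A -> closed A.
Proof.
apply: (@accessible_finite_set_closed X).1.
exact/hausdorff_accessible/metric_hausdorff.
Qed.

Lemma closure_image_close (R : realType) (X : metricType R) (T : Type)
    (a : set T) (u v : T -> X) :
  (forall e : R, (0 < e)%R ->
    finite_set [set i | a i /\ (e <= mdist (u i) (v i))%R]) ->
  closure (u @` a) `<=` closure (v @` a) `|` u @` a.
Proof.
move=> fin y uay.
have [|/existsNP[B /not_implyP[yB vaB]]] := pselect (closure (v @` a) y).
  by left.
right; move: yB => /nbhs_ballP[r /= r0 rB].
have r20 : (0 < r / 2)%R by rewrite divr_gt0.
have /(finite_image u)/closed_finite_metric cF := fin _ r20.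
suff /cF[i [ai _] <-] : closure
    (u @` [set i | a i /\ (r / 2 <= mdist (u i) (v i))%R]) y by exists i.
move=> C yC; have /uay : nbhs y (C `&` ball y (r / 2)).
  by apply: filterI => //; exact: nbhsx_ballx.
move=> [_ [[i ai <-] [Cui yui]]]; exists (u i); split => //; exists i => //.
split => //; rewrite leNgt; apply/negP => uvi; apply: vaB.
exists (v i); split; first by exists i.
apply: rB; rewrite [r]splitr; apply: ball_triangle yui _.
by rewrite ballEmdist.
Qed.

Lemma ideal_isomorphic_close (R : realType) (X : metricType R)
    (I : set (set X)) (A B : set X) (f : X -> X) :
  sigma_ideal I -> countable A -> set_bij A B f ->
  (forall e : R, (0 < e)%R ->
    finite_set [set x | A x /\ (e <= mdist x (f x))%R]) ->
  ideal_isomorphic A B (closure_ideal I A) (closure_ideal I B).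
Proof.
move=> sI cA fAB fin; exists f => // a aA.
have ca : countable a by apply: sub_countable cA; exact: subset_card_le.
have transfer (u v : X -> X) : (forall e : R, (0 < e)%R ->
    finite_set [set x | A x /\ (e <= mdist (u x) (v x))%R]) ->
    I (closure (v @` a)) -> I (closure (u @` a)).
  move=> uv Iv.
  apply: (sigma_ideal_subset sI (B := closure (v @` a) `|` u @` a)).
    apply: closure_image_close => e /uv; apply: sub_finite_set.
    by move=> x [/aA].
  apply: (sigma_ideal_setU sI Iv).
  exact: (sigma_ideal_countable sI (sub_countable (card_image_le u _) ca)).
split => -[_ Ia]; split => //.
- by move=> _ [x ax <-]; case: fAB => + _ _; apply; exact: aA.
- apply: (transfer f id); last by rewrite image_id.
  by move=> e /fin; apply: sub_finite_set => x; rewrite /= metric_sym.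
- by rewrite -[a]image_id; exact: (transfer id f).
Qed.

(** * Disjoint sequences and the shift along them *)

Lemma distinct_representatives (T : choiceType) (U : nat -> set T) :
  (forall n, infinite_set (U n)) ->
  exists2 t : nat -> T, injective t & forall n, U n (t n).
Proof.
move=> Uinf; have /choice[h hP] (p : nat * seq T) :
    exists x, U p.1 x /\ x \notin p.2.
  have /infinite_setN0[x [Ux /= /negP xp]] :=
    infinite_setD (Uinf p.1) (finite_seq p.2).
  by exists x.
(* [L n] lists the points chosen before stage [n], and [h] picks a point of [U n] outside this
   list. *)
pose L := fix L n := if n is m.+1 then h (m, L m) :: L m else [::].
pose t n := h (n, L n); have tL m n : (m < n)%N -> t m \in L n.
  elim: n => // n IHn; rewrite ltnS leq_eqVlt => /orP[/eqP ->|/IHn tLn] /=.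
    by rewrite inE eqxx.
  by rewrite inE tLn orbT.
have tneq m n : (m < n)%N -> t m <> t n.
  by move=> /tL + tmn; rewrite tmn; apply/negP; exact: (hP (n, L n)).2.
exists t => [m n tmn|n]; last exact: (hP (n, L n)).1.
by case: (ltngtP m n) => // /tneq; rewrite tmn.
Qed.

Lemma hilbert_hotel (T : Type) (Q E : set T) (s : T -> nat -> T) :
  Q `&` E = set0 -> (forall q j, Q q -> E (s q j)) ->
  (forall p q i j, Q p -> Q q -> s p i = s q j -> p = q /\ i = j) ->
  exists2 f : T -> T, set_bij (Q `|` E) E f & forall x, (Q `|` E) x ->
    [\/ f x = x, Q x /\ f x = s x 0 |
        exists q j, [/\ Q q, x = s q j & f x = s q j.+1]].
Proof.
move=> QE sE sinj; have nQE x : Q x -> ~ E x.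
  by move=> Qx Ex; have : set0 x by rewrite -QE.
pose S x := exists q j, Q q /\ x = s q j.
have SE x : S x -> E x by move=> [q [j [Qq ->]]]; exact: sE.
(* The three cases exclude each other because [Q] misses [E], and injectivity of [s] makes [q] and
   [j] unique; hence [fQ] and [fS] determine [f] on [Q] and on the sequences. *)
have /choice[f fP] x : exists y, [\/ Q x /\ y = s x 0,
    exists q j, [/\ Q q, x = s q j & y = s q j.+1] |
    [/\ ~ Q x, ~ S x & y = x]].
  have [Qx|nQx] := pselect (Q x); first by exists (s x 0); constructor 1.
  have [[q [j [Qq xqj]]]|nSx] := pselect (S x).
    by exists (s q j.+1); constructor 2; exists q, j.
  by exists x; constructor 3.
have fQ x : Q x -> f x = s x 0.
  move=> Qx; case: (fP x) => [[]//|[q [j [Qq xqj _]]]|[]//].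
  by case: (nQE _ Qx); rewrite xqj; exact: sE.
have fS q j : Q q -> f (s q j) = s q j.+1.
  move=> Qq; case: (fP (s q j)) => [[Qs]|[p [i [Qp qjpi ->]]]|[_ []]].
  - by case: (nQE _ Qs); exact: sE.
  - by have [-> ->] := sinj _ _ _ _ Qq Qp qjpi.
  - by exists q, j.
exists f; last first.
  by move=> x _; case: (fP x) => [?|?|[_ _ ?]];
    [constructor 2|constructor 3|constructor 1].
split.
- move=> x QEx; case: (fP x) => [[Qx ->]|[q [j [Qq _ ->]]]|[nQx _ ->]];
    [exact: sE|exact: sE|by case: QEx].
- move=> x y _ _.
  case: (fP x) => [[Qx ->]|[q [j [Qq -> ->]]]|[nQx nSx ->]];
  case: (fP y) => [[Qy ->]|[p [i [Qp -> ->]]]|[nQy nSy ->]] //.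
  + by move=> /sinj[].
  + by move=> /sinj[].
  + by move=> sy; case: nSy; exists x, 0.
  + by move=> /sinj[].
  + by move=> /sinj[]// -> [->].
  + by move=> sy; case: nSy; exists q, j.+1.
  + by move=> sx; case: nSx; exists y, 0.
  + by move=> sx; case: nSx; exists p, i.+1.
- move=> y Ey; have [[q [[|j] [Qq ->]]]|nSy] := pselect (S y).
  + by exists q; [left|exact: fQ].
  + by exists (s q j); [right; exact: sE|exact: fS].
  + exists y; [by right|case: (fP y) => [[/nQE//]|[q [j [Qq yqj _]]]|[]//]].
    by case: nSy; exists q, j.
Qed.

(** Were the intersection finite, hence closed, removing it from the interior of the ball would
    leave an open set that contains [q] and misses [E]. *)
Lemma dense_infinite_ball (R : realType) (X : metricType R) (E : set X)
    (q : X) (r : R) :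
  dense E -> ~ E q -> (0 < r)%R -> infinite_set (E `&` ball q r).
Proof.
move=> dE nEq r0 /closed_finite_metric cF.
have qF : (~` (E `&` ball q r)) q by move=> [].
have [||x [[xr xF] Ex]] := dE ((ball q r)^° `&` ~` (E `&` ball q r)).
- by exists q; split => //; exact: nbhsx_ballx.
- by apply: openI; [exact: open_interior|rewrite openC].
- by apply: xF; split => //; exact: interior_subset xr.
Qed.

(** All pairs [(q, j)] are coded by single naturals [k], and the [k]-th point is chosen within
    [1 / (k + 1)] of its [q]. One index for all sequences makes the distances tend to 0 jointly. *)
Lemma disjoint_approximations (R : realType) (X : metricType R)
    (Q E : set X) :
  countable Q ->
  (forall q (r : R), Q q -> (0 < r)%R -> infinite_set (E `&` ball q r)) ->
  exists s : X -> nat -> X,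
    [/\ forall q j, Q q -> E (s q j),
        forall p q i j, Q p -> Q q -> s p i = s q j -> p = q /\ i = j &
        forall e : R, (0 < e)%R -> finite_set
          [set x | exists q j, [/\ Q q, x = s q j & (e <= mdist q x)%R]]].
Proof.
move=> /countable_injP[code codeI] QE.
have [->|/set0P[q0 Qq0]] := eqVneq Q set0.
  exists (fun q _ => q); split => // e _.
  by rewrite (_ : mkset _ = set0)// -subset0 => x [? [? []]].
have pcodeI p q (i j : nat) : Q p -> Q q ->
    pickle (code p, i) = pickle (code q, j) -> p = q /\ i = j.
  move=> Qp Qq /(pcan_inj pickleK)[/codeI pq ->]; split => //.
  by apply: pq; exact: mem_set.
(* [c k] is the centre decoded from [k], with default [q0] when [k] codes no pair. *)
have /choice[c cP] k : exists y, Q y /\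
    forall q (j : nat), Q q -> pickle (code q, j) = k -> y = q.
  have [[p [i [Qp pik]]]|nk] := pselect (exists p (i : nat),
      Q p /\ pickle (code p, i) = k).
    by exists p; split => // q j Qq; rewrite -pik => /pcodeI[].
  by exists q0; split => // q j Qq qjk; case: nk; exists q, j.
have [|t tI tP] := @distinct_representatives X
    (fun k => E `&` ball (c k) (k.+1%:R^-1 : R)%R).
  by move=> k; apply: QE; [exact: (cP k).1|rewrite invr_gt0].
pose s q (j : nat) := t (pickle (code q, j)).
exists s; split.
- by move=> q j Qq; exact: (tP _).1.
- by move=> p q i j Qp Qq /tI /pcodeI; apply.
(* From [N] on the radii are below [e], so only points with index below [N] can be [e] or more from
   their centre. *)
- move=> e e0; have [N _ Ne] := near_infty_natSinv_lt (PosNum e0).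
  apply: sub_finite_set (finite_image t (finite_II N)).
  move=> x [q [j [Qq -> eqs]]]; exists (pickle (code q, j)) => //=.
  rewrite ltnNge; apply/negP => /Ne /=; apply/negP; rewrite -leNgt ltW//.
  apply: le_lt_trans eqs _; have := (tP (pickle (code q, j))).2.
  by rewrite ((cP _).2 _ _ Qq erefl) ballEmdist.
Qed.

(** * Comparison of a dense set with the union *)

Lemma ideal_isomorphic_setU (R : realType) (X : metricType R)
    (I : set (set X)) (D E : set X) :
  sigma_ideal I -> countable D -> countable E -> dense E ->
  ideal_isomorphic (D `|` E) E
    (closure_ideal I (D `|` E)) (closure_ideal I E).
Proof.
(* The hotel needs newcomers outside [E], so [D] is replaced by [D]\[E]. *)
move=> sI cD cE dE; have -> : D `|` E = D `\` E `|` E by rewrite setUDl setDv setD0.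
have cQ : countable (D `\` E).
  by apply: sub_countable cD; apply: subset_card_le => x [].
have [s [sE sinj sfin]] := @disjoint_approximations R X (D `\` E) E cQ
    (fun q r Qq => @dense_infinite_ball R X E q r dE Qq.2).
have [|f fbij fP] := @hilbert_hotel X (D `\` E) E s _ sE sinj.
  by rewrite setDE -setIA setICl setI0.
apply: (@ideal_isomorphic_close R X I _ _ f) => //.
  by rewrite -bigcup2inE; apply: bigcup_countable => // -[|[|]].
move=> e e0; have e20 : (0 < e / 2)%R by rewrite divr_gt0.
have finB := sfin _ e20; set B := mkset _ in finB.
(* [B] holds the sequence points at least [e / 2] from their limit; its preimage is finite by
   injectivity of [f]. *)
have finfB : finite_set [set x | (D `\` E `|` E) x /\ B (f x)].
  have [_ finj _] := fbij.
  rewrite -(eq_finite_set (inj_card_eq (f := f) _)).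
    by apply: sub_finite_set finB => _ [x [_ Bfx] <-].
  by move=> x y /set_mem[Ax _] /set_mem[Ay _]; apply: finj; exact: mem_set.
(* A point moved by [e] or more lies in [B] or is sent into [B]: a shift from [s q j] to [s q j.+1]
   is compared with [q] by the triangle inequality, which is why [e] is halved. *)
apply: (@sub_finite_set _ _ (B `|` [set x | (D `\` E `|` E) x /\ B (f x)])).
  move=> x [Ax exfx]; case: (fP _ Ax) => [fx|[Qx fx]|[q [j [Qq xqj fx]]]].
  - by move: exfx; rewrite fx mdistxx leNgt e0.
  - right; split => //; exists x, 0; split => //.
    by apply: le_trans exfx; rewrite ler_pdivrMr// ler_peMr ?ler1n// ltW.
  - have [eqx|qxe] := leP (e / 2)%R (mdist q x); first by left; exists q, j.
    right; split => //; exists q, j.+1; split => //.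
    rewrite leNgt; apply/negP => qfxe; move: exfx; rewrite leNgt => /negP; apply.
    rewrite [e]splitr; apply: le_lt_trans (ltrD qxe qfxe).
    by rewrite [mdist q x]metric_sym metric_triangle.
by rewrite finite_setU.
Qed.

Unset Implicit Arguments.
Set Strict Implicit.

Theorem proposition2p1 (R : realType) (X : metricType R) (I : set (set X))
    (D E : set X) :
  separable X -> sigma_ideal I ->
  countable D -> dense D -> countable E -> dense E ->
  ideal_isomorphic D E (closure_ideal I D) (closure_ideal I E).
Proof.
move=> _ sI cD dD cE dE.
have DE := @ideal_isomorphic_setU R X I D E sI cD cE dE.
have := @ideal_isomorphic_setU R X I E D sI cE cD dD.
rewrite setUC => /ideal_isomorphic_sym /ideal_isomorphic_trans; exact.
Qed.
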